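(* Suppose $\mathcal{U}$ is a finite iterate of Fubini products of p-points. If $\mathcal{V}$ is a q-point and $\mathcal{V}\le_T\mathcal{U}$, then $\mathcal{V}\le_{RK}\mathcal{U}$.
   Context: A p-point is a nonprincipal ultrafilter on $\omega$ such that for every decreasing sequence $X_0\supseteq X_1\supseteq\cdots$ of its members there is a member $U$ with $U\setminus X_n$ finite for all $n$. The Fubini product of ultrafilters $\mathcal{W}$ and $\mathcal{V}_n$ ($n<\omega$) is $\lim_{n\to\mathcal{W}}\mathcal{V}_n=\{A\subseteq\omega\times\omega:\{n:\{j:(n,j)\in A\}\in\mathcal{V}_n\}\in\mathcal{W}\}$ (for ultrafilters on other countable sets, use the analogous definition on the corresponding product). Let $\mathcal{P}_0$ be the set of p-points and $\mathcal{P}_{n+1}=\{\lim_{i\to\mathcal{W}}\mathcal{V}_i:\mathcal{W}\in\mathcal{P}_0,\ \mathcal{V}_i\in\mathcal{P}_n\}$; a finite iterate of Fubini products of p-points is a member of $\bigcup_{n<\omega}\mathcal{P}_n$. A q-point is a nonprincipal ultrafilter on $\omega$ such that every partition of $\omega$ into finite sets has a member meeting each piece in at most one point. $\mathcal{V}\le_T\mathcal{U}$ iff there is a map $\mathcal{U}\to\mathcal{V}$ sending cofinal subsets of $(\mathcal{U},\supseteq)$ to cofinal subsets of $(\mathcal{V},\supseteq)$. $\mathcal{V}\le_{RK}\mathcal{U}$ iff there is a function $h$ from the base set of $\mathcal{U}$ to that of $\mathcal{V}$ with $\mathcal{V}=\{Y: h^{-1}(Y)\in\mathcal{U}\}$.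 *)

(* Defs.v *)
From mathcomp Require Import all_boot all_classical.

Set Implicit Arguments.
Unset Strict Implicit.
Unset Printing Implicit Defensive.

Local Open Scope classical_set_scope.

Definition nonprincipal_ultrafilter (T : Type) (U : set_system T) : Prop :=
  UltraFilter U /\ forall x : T, U <> principal_filter x.

Definition p_point (U : set_system nat) : Prop :=
  nonprincipal_ultrafilter U /\
  forall X : nat -> set nat,
    (forall n, U (X n)) -> (forall n, X n.+1 `<=` X n) ->
    exists2 Y, U Y & forall n, finite_set (Y `\` X n).

(* A partition is given by its set of (nonempty) pieces. *)
Definition q_point (U : set_system nat) : Prop :=
  nonprincipal_ultrafilter U /\
  forall P : set_system nat,
    partition P id [set: nat] -> (forall A, P A -> finite_set A) ->
    exists2 Y, U Y & forall A, P A -> is_subset1 (Y `&` A).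

Definition fubini_lim (T : Type) (W : set_system nat)
    (V : nat -> set_system T) : set_system (nat * T) :=
  [set A | W [set n | V n [set j | A (n, j)]]].

(* The level n iterates live on the (n+1)-fold product nat * (nat * ...). *)
Fixpoint iterate_base (n : nat) : Type :=
  if n is m.+1 then (nat * iterate_base m)%type else nat.

Fixpoint fubini_iterate (n : nat) : set (set_system (iterate_base n)) :=
  match n with
  | 0 => p_point
  | m.+1 =>
      [set U | exists W V, [/\ p_point W,
                               forall i, @fubini_iterate m (V i) &
                               U = fubini_lim W V]]
  end.
Arguments fubini_iterate : clear implicits.

Definition cofinal (T : Type) (U B : set_system T) : Prop :=
  B `<=` U /\ forall A, U A -> exists2 X, B X & X `<=` A.

(* A map U -> V is represented by a function on all subsets that sends
   members of U to members of V; its values outside U are irrelevant. *)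
Definition tukey_le (S T : Type) (V : set_system S) (U : set_system T) : Prop :=
  exists f : set T -> set S,
    set_fun U V f /\ forall B, cofinal U B -> cofinal V (f @` B).

Definition RK_le (S T : Type) (V : set_system S) (U : set_system T) : Prop :=
  exists h : T -> S, V = [set Y | U (h @^-1` Y)].

(* Main.v *)
Require Import Defs.
From mathcomp Require Import all_boot all_classical zify.

(** Write a finite iterate U of p-points as an iterated limit, along the tree
    of sequences of length at most d, of p-points attached to the nodes.
    Given a monotone cofinal map f from U to V, put x in psi(s), for a finite
    set s of nodes, when x lies in f(A) for every A in U that is large below
    each node of s.  Diagonalising with the p-point property at every node
    yields X0 in U and finite sets K_x of nodes such that, for X below X0,
    x in f(X) implies that x is in psi(s) for some set s of nodes in K_x below
    which X is large.

    Then G(X) = {min psi(s)} is contained in f(X) and is nonempty, hence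
    belongs to V because f is cofinal.  The point of taking only the minimum is
    that the nodes of a given K_x produce finitely many values.  Since V is a
    q-point, it has a member E so sparse that values produced by K_e lie below
    the next element of E.  Hence each y in the intersection of G(X) and E
    needs a node of K_y lying in no earlier K_e, and sending a node to the
    first e in E with the node in K_e recovers y.  Composing with the d + 1
    maps t |-> t|j gives finitely many candidate Rudin-Keisler reductions, one
    of which succeeds. *)

Set Implicit Arguments.
Unset Strict Implicit.
Unset Printing Implicit Defensive.

Local Open Scope classical_set_scope.

(** * Ultrafilters *)

Lemma ultra_of_setVsetC T (F : set_system T) :
  ProperFilter F -> (forall A, F A \/ F (~` A)) -> UltraFilter F.
Proof.
move=> PF FVC; split=> // G PG sFG; rewrite eqEsubset; split=> // A GA.
have [//|/sFG GCA] := FVC A; case: (@filter_not_empty _ G PG).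
by rewrite -(setICr A); apply: filterI.
Qed.

Lemma ultra_setC T (F : set_system T) A : UltraFilter F -> ~ F A -> F (~` A).
Proof. by move=> UF nFA; case: (in_ultra_setVsetC A UF). Qed.

Lemma filter_forall_leq T (F : set_system T) n (A : nat -> set T) :
  Filter F -> (forall i, i <= n -> F (A i)) ->
  F [set t | forall i, i <= n -> A i t].
Proof.
move=> FF FA; apply: (@filterS _ _ _ [set t | forall i : 'I_n.+1, A i t]).
  by move=> t At i lein; have := At (Ordinal (lein : i < n.+1)).
by apply: filter_forall => i; apply: FA; rewrite -ltnS.
Qed.

Lemma ultra_exists_leq T (F : set_system T) n (A : nat -> set T) :
  UltraFilter F -> F [set t | exists2 i, i <= n & A i t] ->
  exists2 i, i <= n & F (A i).
Proof.
move=> UF FA; apply: contrapT => nA.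
have FC : F [set t | forall i, i <= n -> (~` A i) t].
  apply: filter_forall_leq => i lein; apply: ultra_setC => FAi.
  by apply: nA; exists i.
have [t [[i lein Ait] /(_ i lein)]] := filter_ex (filterI FA FC).
exact.
Qed.

Lemma ultra_image_RK S T (V : set_system S) (U : set_system T) (h : T -> S) :
  UltraFilter V -> ProperFilter U ->
  (forall Y, V Y -> U (h @^-1` Y)) -> V = [set Y | U (h @^-1` Y)].
Proof.
move=> UV PU VU; rewrite eqEsubset; split=> // Y /= UY.
have [//|/VU UCY] := in_ultra_setVsetC Y UV.
by have [t [] ] := filter_ex (filterI UY UCY).
Qed.

Lemma mem_leq_sumn (s : seq nat) v : v \in s -> v <= sumn s.
Proof. by move=> /perm_to_rem/perm_sumn -> /=; apply: leq_addr. Qed.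

(** A pseudo-intersection of the sets [X n] satisfies condition [k] past some threshold [l k];
    intersecting it with [X b] makes the conditions up to [b] hold with no threshold. *)
Lemma p_point_diag (W : set_system nat) (C : nat -> set nat) (b : nat) :
  p_point W -> (forall k, W (C k)) ->
  exists (D : set nat) (l : nat -> nat), W D /\
    forall k v, D v -> k <= b \/ l k <= v -> C k v.
Proof.
move=> [[UW _] pW] WC.
pose X n := [set v | forall k, k <= n -> C k v].
have WX n : W (X n) by apply: filter_forall_leq.
have [|Y WY finY] := pW X WX.
  by move=> n v Xv k lekn; apply: Xv; apply: leqW.
have /choice[l lP] n : exists m, forall v, Y v -> m <= v -> X n v.
  have /finite_seqP[s sE] := finY n.
  exists (sumn s).+1 => v Yv ltv; apply: contrapT => nXv.
  have : [set` s] v by rewrite -sE.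
  by move=> /mem_leq_sumn; rewrite leqNgt ltv.
exists (Y `&` X b), l; split; first exact: filterI.
move=> k v [Yv Xbv] [lekb|lelv]; first exact: Xbv.
exact: (lP k).
Qed.

(** [idx v] numbers the interval from [m i] to [m i.+1] that contains [v]; the adjunction form
    serves both bounds at once. *)
Lemma exists_interval_index (m : nat -> nat) :
  m 0 = 0 -> (forall i, m i < m i.+1) ->
  exists idx : nat -> nat, forall v i, (m i <= v) = (i <= idx v).
Proof.
move=> m0 mS.
have m_mono : {mono m : i j / i <= j}.
  by apply: leq_mono; apply: homo_ltn ltn_trans mS.
suff /choice[idx idxP] v : exists j, m j <= v < m j.+1.
  exists idx => v i; have /andP[lo hi] := idxP v; apply/idP/idP => [miv|leiv].
    by rewrite -ltnS -(leqW_mono m_mono) (leq_ltn_trans miv).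
  by rewrite (leq_trans _ lo) // m_mono.
elim: v => [|v [j /andP[lo hi]]].
  by exists 0; have := mS 0; rewrite m0 => ->.
have := mS j.+1; have [eqv|neqv] := eqVneq v.+1 (m j.+1) => ?.
  by exists j.+1; lia.
by exists j; lia.
Qed.

(** Select one point per interval of a partition growing faster than [q], then keep the intervals of
    one parity: a whole interval separates two chosen points, which leaves room for [q]. *)
Lemma q_point_sparse (V : set_system nat) (q : nat -> nat) :
  q_point V ->
  exists2 E, V E & forall e e', E e -> E e' -> e < e' -> q e < e'.
Proof.
move=> [[UV _] qV].
have [m [m0 mS qm]] : exists m : nat -> nat, [/\ m 0 = 0,
    forall i, m i < m i.+1 & forall i y, y <= m i -> q y < m i.+1].
  exists (fun i => iter i (fun n => (n + \max_(y < n.+1) q y).+1) 0).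
  split=> // [i|i y ley] /=; first by rewrite ltnS leq_addr.
  rewrite ltnS; apply: leq_trans (leq_addl _ _).
  exact: (@leq_bigmax _ (fun y : 'I__ => q y) (Ordinal (ley : y < _.+1))).
have [idx idxP] := exists_interval_index m0 mS.
have idxm i : idx (m i) = i.
  by apply/eqP; rewrite eqn_leq -idxP leqnn andbT -ltnS ltnNge -idxP -ltnNge.
pose piece i := [set v | idx v = i].
have [||Y VY Y1] := qV [set piece i | i in setT].
- split.
  + by rewrite -subTset => v _; exists (piece (idx v)) => //; exists (idx v).
  + by move=> _ _ [i _ <-] [j _ <-] [v [/= <- <-]].
  + by move=> _ [i _ <-]; exists (m i); apply: idxm.
- move=> _ [i _ <-]; apply: (@sub_finite_set _ _ `I_(m i.+1)) => // v /= vi.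
  by rewrite ltnNge idxP vi ltnn.
pose par b := [set v | odd (idx v) = b].
have [b Vb] : exists b, V (par b).
  have [Vt|Vf] := in_ultra_setVsetC (par true) UV; first by exists true.
  by exists false; apply: filterS Vf => v /negP/negbTE.
exists (Y `&` par b); first exact: filterI.
move=> e e' [Ye be] [Ye' be'] lte.
have neq : idx e <> idx e'.
  move=> eqidx; suff : e = e' by lia.
  by apply: (Y1 (piece (idx e))); [exists (idx e)|split|split].
have lei : idx e <= idx e' by rewrite -idxP (leq_trans _ (ltnW lte)) // idxP.
have le2 : (idx e).+2 <= idx e' by move: be be'; rewrite /par /=; lia.
apply: (@leq_trans (m (idx e).+2)); last by rewrite idxP.
by apply: qm; rewrite leqNgt; apply/negP => /ltnW; rewrite idxP ltnn.
Qed.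

(** * Iterated limits along trees *)

(** [W p] is the ultrafilter attached to the node [p]. The limit lives on all finite sequences and
    concentrates on those of length [d], which avoids a base type depending on [d]. *)
Fixpoint treelim (d : nat) (W : seq nat -> set_system nat) :
    set_system (seq nat) :=
  if d is d'.+1 then
    [set A | W [::] [set n |
      treelim d' (fun p => W (n :: p)) [set t | A (n :: t)]]]
  else [set A | A [::]].

(* [large d W X p]: the set of [r] such that [X (p ++ r)] belongs to the
   iterated limit of the ultrafilters attached to the nodes extending [p]. *)
Fixpoint large (d : nat) (W : seq nat -> set_system nat) (X : set (seq nat))
    (p : seq nat) {struct p} : Prop :=
  match p, d with
  | [::], _ => treelim d W X
  | n :: p', d'.+1 =>
      large d' (fun r => W (n :: r)) [set t | X (n :: t)] p'
  | _ :: _, 0 => False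
  end.

Definition core (d : nat) (W : seq nat -> set_system nat) (X : set (seq nat)) :
    set (seq nat) :=
  [set t | size t = d /\ forall p, prefix p t -> large d W X p].

Lemma treelim_ultra d (W : seq nat -> set_system nat) :
  (forall p, UltraFilter (W p)) -> UltraFilter (treelim d W).
Proof.
elim: d W => [|d IH] W UW /=.
  have -> : (fun A : set (seq nat) => A [::]) = principal_filter [::].
    by rewrite predeqE => A; apply: iff_sym; apply: principal_filterP.
  exact: principal_filter_ultra.
have {}IH n : UltraFilter (treelim d (fun p => W (n :: p))) by apply: IH.
apply: ultra_of_setVsetC => [|A].
  split=> [W0|].
    by have [n] := @filter_ex _ (W [::]) _ _ W0; apply: filter_not_empty.
  split=> [|A B|A B sAB] /=.
  - by apply: filterE => n; apply: filterE.
  - by apply: filterS2 => n; apply: filterI.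
  - by apply: filterS => n; apply: filterS => t; apply: sAB.
have [|WC] := in_ultra_setVsetC
  [set n | treelim d (fun p => W (n :: p)) [set t | A (n :: t)]] (UW [::]).
  by left.
by right; apply: filterS WC => n /= nA; apply: ultra_setC nA.
Qed.

Lemma treelim_branch d (W : seq nat -> set_system nat)
    (D : seq nat -> set nat) :
  (forall p, UltraFilter (W p)) -> (forall p, W p (D p)) ->
  treelim d W
    [set t | size t = d /\ forall p k, prefix (rcons p k) t -> D p k].
Proof.
elim: d W D => [|d IH] W D UW WD /=; first by split=> // -[].
apply: filterS (WD [::]) => n Dn /=.
have UWn p : UltraFilter (W (n :: p)) by [].
have := IH _ (fun p => D (n :: p)) UWn (fun p => WD (n :: p)).
have Un := treelim_ultra d UWn.
apply: filterS => t /= [-> Dt]; split=> // -[|v p] k /=.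
  by rewrite prefix0s andbT => /eqP ->.
by move=> /andP[/eqP -> /Dt].
Qed.

Lemma large_rcons d (W : seq nat -> set_system nat) X p :
  large d W X p -> size p < d -> W p [set k | large d W X (rcons p k)].
Proof.
elim: p d W X => [|n p IH] [|d] W X //= Lp.
exact: (IH _ _ _ Lp).
Qed.

Lemma large_sub d (W : seq nat -> set_system nat) X Y p :
  (forall p, UltraFilter (W p)) -> X `<=` Y -> large d W X p -> large d W Y p.
Proof.
elim: p d W X Y => [|n p IH] d W X Y UW sXY.
  by have UL := treelim_ultra d UW; apply: filterS.
by case: d => //= d; apply: IH => // t; apply: sXY.
Qed.

Lemma large_size d (W : seq nat -> set_system nat) X p :
  large d W X p -> size p <= d.
Proof. by elim: p d W X => [|n p IH] [|d] W X //= /IH. Qed.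

Lemma large_leaf d (W : seq nat -> set_system nat) X p :
  large d W X p -> size p = d -> X p.
Proof.
elim: p d W X => [|n p IH] [|d] W X //=.
by move=> /IH; move=> h [/h].
Qed.

Lemma large_prefix d (W : seq nat -> set_system nat) X p :
  (forall p, UltraFilter (W p)) -> large d W X p ->
  exists2 t, X t & prefix p t.
Proof.
elim: p d W X => [|n p IH] d W X UW.
  have UL := treelim_ultra d UW.
  by move=> /filter_ex[t Xt]; exists t => //; apply: prefix0s.
case: d => //= d /(IH _ _ _ (fun p => UW (n :: p)))[t Xt pt].
exists (n :: t) => //=.
by rewrite eqxx.
Qed.

Lemma core_sub d (W : seq nat -> set_system nat) X : core d W X `<=` X.
Proof. by move=> t [st Lt]; apply: (large_leaf (Lt t (prefix_refl t))). Qed.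

Lemma prefix_of_rcons (p t : seq nat) k : prefix (rcons p k) t -> prefix p t.
Proof. exact/prefix_trans/prefix_rcons. Qed.

(** Almost all children of a large node are large, so almost every branch stays at large nodes from
    the root on. *)
Lemma treelim_core d (W : seq nat -> set_system nat) X :
  (forall p, UltraFilter (W p)) -> treelim d W X -> treelim d W (core d W X).
Proof.
move=> UW LX; have UL := treelim_ultra d UW.
pose D p := [set k | large d W X p -> size p < d -> large d W X (rcons p k)].
have WD p : W p (D p).
  have [[Lp sp]|nLp] := pselect (large d W X p /\ size p < d).
    by apply: filterS (large_rcons Lp sp) => k Lk _ _.
  by apply: filterE => k Lp sp; case: nLp.
apply: filterS (treelim_branch d UW WD) => t [st Dt]; split=> //.
elim/last_ind=> [|p k IH] // pt; apply: (Dt p k pt (IH (prefix_of_rcons pt))).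
by have := size_prefix pt; rewrite size_rcons st.
Qed.

Fixpoint nodes (d k : nat) : seq (seq nat) :=
  if d is d'.+1 then
    [::] :: [seq v :: p | v <- iota 0 k, p <- nodes d' k]
  else [:: [::]].

Lemma mem_nodes d k p :
  (p \in nodes d k) = (size p <= d) && all (fun v => v < k) p.
Proof.
elim: d p => [|d IH] [|v p] //=.
rewrite inE /= ltnS andbCA -IH; apply/allpairsP/andP => /=.
  by move=> [[u q] /= [ku qd [-> ->]]]; rewrite mem_iota in ku.
by move=> [vk pd]; exists (v, p); rewrite /= mem_iota.
Qed.

Lemma nodes_subset d k l : k <= l -> {subset nodes d k <= nodes d l}.
Proof.
move=> lekl p; rewrite !mem_nodes => /andP[-> /=].
by apply: sub_all => v /leq_trans; apply.
Qed.

(** Filtered sublists stand for the subsets of a finite set of nodes. *)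
Lemma bounded_on_subseqs (T : Type) (g : seq T -> nat) (e : seq T) :
  exists b, forall a : pred T, g (seq.filter a e) <= b.
Proof.
elim: e g => [|x e IH] g; first by exists (g [::]).
have [b1 h1] := IH g; have [b2 h2] := IH (fun s => g (x :: s)).
exists (maxn b1 b2) => a; rewrite leq_max /=.
by case: (a x); rewrite ?h1 ?h2 ?orbT.
Qed.

Lemma filter_forall_subseqs (S T : Type) (F : set_system S)
    (C : seq T -> set S) (e : seq T) :
  Filter F -> (forall s, F (C s)) ->
  F [set v | forall a : pred T, C (seq.filter a e) v].
Proof.
move=> FF; elim: e C => [|x e IH] C FC.
  by apply: filterS (FC [::]) => v Cv a.
have := IH (fun s => C (x :: s)) (fun s => FC (x :: s)).
apply: filterS2 (IH C FC) => v Cv Cxv a /=.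
by case: (a x); [apply: Cxv|apply: Cv].
Qed.

(** * Finitary approximation of monotone maps *)

Lemma missed_residue d (g : nat -> nat) (t : seq nat) :
  size t = d -> exists2 r, r <= d & forall v, v \in t -> g v != r.
Proof.
move=> st; apply: contrapT => nr.
suff /uniq_leq_size : {subset iota 0 d.+1 <= map g t}.
  by rewrite iota_uniq size_map size_iota st ltnn => /(_ isT).
move=> r; rewrite mem_iota /= ltnS => lerd; apply: contrapT => /negP nrt.
case: nr; exists r => // v vt; apply: contraNneq nrt => <-.
exact: map_f.
Qed.

(** Let [s] be the nodes in [nodes d (kappa x)] below which [X] is large. If the conclusion failed,
    the counterexample [Aw (s, x)], chosen in advance, would be large at [s]. [X0] is so thin that
    branches of [core d W X] leaving the finite set of nodes stay large for it; then its core
    contains that of [X], against monotonicity. *)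
Lemma finitary_approximation d (W : seq nat -> set_system nat)
    (f : set (seq nat) -> set nat) :
  (forall p, p_point (W p)) -> (forall A B, A `<=` B -> f A `<=` f B) ->
  exists (X0 : set (seq nat)) (kappa : nat -> nat),
    [/\ treelim d W X0, {homo kappa : x y / x <= y} &
        forall X x, X `<=` X0 -> f (core d W X) x ->
        forall A, treelim d W A ->
          (forall p, p \in nodes d (kappa x) -> large d W X p ->
             large d W A p) ->
          f (core d W A) x].
Proof.
move=> pW fmono; have UW p : UltraFilter (W p) by case: (pW p) => -[].
have UL := treelim_ultra d UW.
pose escapes (sx : seq (seq nat) * nat) A := [/\ treelim d W A,
  forall p, p \in sx.1 -> large d W A p & ~ f (core d W A) sx.2].
have /choice[Aw AwP] sx : exists A, forall B, escapes sx B -> escapes sx A.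
  have [[A eA]|nA] := pselect (exists A, escapes sx A); first by exists A.
  by exists setT => B eB; case: nA; exists B.
pose C p sx := [set v | large d W (Aw sx) p -> size p < d ->
  large d W (Aw sx) (rcons p v)].
have WC p sx : W p (C p sx).
  have [[Lp sp]|nLp] := pselect (large d W (Aw sx) p /\ size p < d).
    by apply: filterS (large_rcons Lp sp) => k Lk _ _.
  by apply: filterE => k Lp sp; case: nLp.
(* Only finitely many pairs [(s, x)] are treated at [k], so the condition is still a member of
   [W p]. *)
pose CC p k := [set v | forall x, x <= k -> forall a : pred (seq nat),
  C p (seq.filter a (nodes d k), x) v].
have WCC p k : W p (CC p k).
  apply: filter_forall_leq => x _.
  by apply: (@filter_forall_subseqs _ _ _ (fun s => C p (s, x))) => s.
(* A node [p] with an entry at least [k] has [k <= sumn p], so the bound [sumn p] exempts it from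
   the threshold. *)
have /choice[Dl DlP] p : exists Dl : set nat * (nat -> nat), W p Dl.1 /\
    forall k v, Dl.1 v -> k <= sumn p \/ Dl.2 k <= v -> CC p k v.
  by have [D [l DlP]] := p_point_diag (sumn p) (pW p) (WCC p); exists (D, l).
(* Interval [i] is so long that its end passes the thresholds for [m i] of all nodes with entries
   below [m i]. *)
have [m [m0 mS ml]] : exists m : nat -> nat, [/\ m 0 = 0,
    forall i, m i < m i.+1 &
    forall i p, p \in nodes d (m i) -> (Dl p).2 (m i) <= m i.+1].
  exists (fun i => iter i (fun n =>
    (n + \max_(p <- nodes d n) (Dl p).2 n).+1) 0).
  split=> // [i|i p pd] /=; first by rewrite ltnS leq_addr.
  apply/leqW/(leq_trans _ (leq_addl _ _)).
  exact: (@leq_bigmax_seq _ _ xpredT (fun p => (Dl p).2 _) p pd isT).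
have [idx idxP] := exists_interval_index m0 mS.
have m_ge i : i <= m i by elim: i => // i IH; apply: leq_ltn_trans IH (mS i).
have m_homo : {homo m : i j / i <= j}.
  by apply: homo_leq => // [|i]; [apply: leq_trans|apply: ltnW].
(* With [d] coordinates and [d + 1] residues, some residue class of intervals
   is avoided by all coordinates of almost every branch. *)
have [r lerd Lr] : exists2 r, r <= d &
    treelim d W [set t | forall v, v \in t -> idx v %% d.+1 != r].
  apply: ultra_exists_leq.
  apply: filterS (treelim_branch d UW (fun p => filterT)) => t [st _].
  exact: (missed_residue (fun v => idx v %% d.+1)).
have LD := treelim_branch d UW (fun p => (DlP p).1).
exists ([set t | size t = d /\
           forall p k, prefix (rcons p k) t -> (Dl p).1 k] `&`
        [set t | forall v, v \in t -> idx v %% d.+1 != r]).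
(* [kappa x] is the left end of an avoided interval, whose index is at least [x], so that also
   [x <= kappa x]. *)
exists (fun x => m (x * d.+1 + r)); split; first exact: filterI.
  by move=> x y lexy; apply: m_homo; rewrite leq_add2r leq_mul2r lexy orbT.
move=> X x sX fXx A LA sXA; apply: contrapT => nfA.
set i := x * d.+1 + r in sXA; set k := m i in sXA.
pose s := [seq p <- nodes d k | `[<large d W X p>]].
have [LB sB nfB] : escapes (s, x) (Aw (s, x)).
  apply: (AwP _ A); split=> //= p.
  by rewrite mem_filter => /andP[/asboolP Xp pd]; apply: sXA.
apply: nfB; apply: fmono fXx => t Xt.
have [[_ Dt] rt] := sX _ (core_sub Xt); have [st Lt] := Xt; split=> //.
elim/last_ind => [//|p v IH] pvt.
have {IH} Bp := IH (prefix_of_rcons pvt).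
have := size_prefix pvt; rewrite size_rcons st => sp.
have [pvd|pvd] := boolP (rcons p v \in nodes d k).
  apply: sB => /=; rewrite mem_filter pvd andbT; apply/asboolP.
  exact: Lt.
suff Cv : CC p k v.
  apply: (Cv x _ _ Bp sp); apply: leq_trans (m_ge i).
  by rewrite /i (leq_trans _ (leq_addr _ _)) // leq_pmulr.
apply: (DlP p).2 (Dt _ _ pvt) _; move: pvd.
rewrite mem_nodes size_rcons sp all_rcons andTb negb_and -leqNgt.
have [pk|pk] := boolP (all (fun u => u < k) p); last first.
  move=> _; left; move/allPn: pk => [u /mem_leq_sumn up].
  by rewrite -leqNgt => /leq_trans; apply.
rewrite orbF => lekv; right.
have pd : p \in nodes d k by rewrite mem_nodes pk ltnW.
(* [v] is at least [m i] and avoids interval [i], whose index has residue [r]; hence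
   [m i.+1 <= v]. *)
apply: leq_trans (ml _ _ pd) _; rewrite idxP ltn_neqAle -idxP lekv andbT.
have vt : v \in t.
  by move/prefixP: pvt => [u ->]; rewrite mem_cat mem_rcons mem_head.
apply: contraNneq (rt v vt) => <-.
by rewrite modnMDl modn_small.
Qed.

(** * Tukey reductions to q-points *)

Lemma treelim_RK d (W : seq nat -> set_system nat) (V : set_system nat)
    (f : set (seq nat) -> set nat) :
  (forall p, p_point (W p)) -> q_point V ->
  (forall A B, A `<=` B -> f A `<=` f B) ->
  (forall A, treelim d W A -> V (f A)) ->
  (forall B, V B -> exists2 A, treelim d W A & f A `<=` B) ->
  RK_le V (treelim d W).
Proof.
move=> pW qV fmono Vf fcof.
have UW p : UltraFilter (W p) by case: (pW p) => -[].
have UL := treelim_ultra d UW; have UV : UltraFilter V by case: qV => -[].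
have [X0 [kappa [LX0 kappa_homo approx]]] := finitary_approximation d pW fmono.
pose psi (s : seq (seq nat)) := [set x | forall A, treelim d W A ->
  (forall p, p \in s -> large d W A p) -> f (core d W A) x].
pose least (P : set nat) x := P x /\ forall y, P y -> x <= y.
have leastP (P : set nat) x : P x -> exists y, least P y.
  move=> Px; have exP : exists y, `[<P y>] by exists x; apply/asboolP.
  exists (ex_minn exP); case: ex_minnP => y /asboolP Py ymin.
  by split=> // z Pz; apply/ymin/asboolP.
(* The nodes are bounded by [kappa] of the produced value [y] itself. *)
pose G X := [set y | exists s, [/\ {subset s <= nodes d (kappa y)},
  forall p, p \in s -> large d W X p & least (psi s) y]].
have Gsub X : treelim d W X -> G X `<=` f (core d W X).
  by move=> LX y [s [_ Xs [psy _]]]; apply: psy.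
have Gne X : treelim d W X -> X `<=` X0 -> exists y, G X y.
  move=> LX sX; have [x fXx] := filter_ex (Vf _ (treelim_core UW LX)).
  (* The least element [y] of [f (core d W X)] works: approximation at [y] puts it in [psi s], and
     [psi s] is included in [f (core d W X)]. *)
  have [y [fXy ymin]] := leastP _ _ fXx.
  exists y, [seq p <- nodes d (kappa y) | `[<large d W X p>]]; split.
  - by move=> p; rewrite mem_filter => /andP[].
  - by move=> p; rewrite mem_filter => /andP[/asboolP].
  split=> [A LA XA|z psz].
    apply: (approx X) => // p pd Xp; apply: XA.
    by rewrite mem_filter pd andbT; apply/asboolP.
  apply: ymin; apply: psz => // p.
  by rewrite mem_filter => /andP[/asboolP].
have VG X : treelim d W X -> X `<=` X0 -> V (G X).
  (* Otherwise some [f A] misses [G X], yet [G] of the intersection of [A] and [X] is nonempty and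
     included in both. *)
  move=> LX sX; apply: contrapT => /(ultra_setC UV)/fcof[A LA fA].
  have [||y Gy] := Gne (A `&` X); first exact: filterI.
    by move=> t [_ /sX].
  apply: (fA y).
    apply: fmono (Gsub _ _ y Gy); last exact: filterI.
    by move=> t /core_sub[].
  case: Gy => s [sd sX' psy]; exists s; split=> // p /sX'.
  by apply: large_sub => // t [].
have /choice[q qP] y : exists b, forall s z, {subset s <= nodes d (kappa y)} ->
    least (psi s) z -> z <= b.
  have /choice[g gP] s : exists z, forall z', least (psi s) z' -> z' <= z.
    have [[z [psz _]]|nz] := pselect (exists z, least (psi s) z).
      by exists z => z' [_]; apply.
    by exists 0 => z' lz'; case: nz; exists z'.
  have [b bP] := bounded_on_subseqs g (nodes d (kappa y)).
  exists b => s z sd lz; apply: leq_trans (bP (mem s)); apply: gP.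
  (* [psi s] depends only on the set of members of [s]. *)
  suff -> : psi [seq p <- nodes d (kappa y) | p \in s] = psi s by [].
  rewrite predeqE => x; split=> psx A LA sA; apply: psx => // p.
    by rewrite mem_filter => /andP[/sA].
  by move=> ps; apply: sA; rewrite mem_filter ps sd.
have [E VE Esparse] := q_point_sparse q qV.
pose stages p := [set e | E e /\ p \in nodes d (kappa e)].
(* [h p] is the first stage in [E] at which [p] appears, with default 0 if it never does. *)
have /choice[h hP] p : exists e, forall e', least (stages p) e' -> e = e'.
  have [[e [se emin]]|ne] := pselect (exists e, least (stages p) e).
    by exists e => e' [se' emin']; apply/eqP; rewrite eqn_leq emin ?emin'.
  by exists 0 => e' le'; case: ne; exists e'.
have hit X y : treelim d W X -> G X y -> E y ->
    exists2 p, large d W X p & h p = y.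
  move=> LX [s [sd Xs psy]] Ey.
  (* Let [e] precede [y] in [E]. Were all of [s] present at stage [e], then [y <= q e < y]; so some
     node of [s] first appears at [y]. *)
  have [[e [Ee ltey emax]]|nE] := pselect (exists e, [/\ E e, e < y &
      forall e', E e' -> e' < y -> e' <= e]).
    have : ~~ all (fun p => p \in nodes d (kappa e)) s.
      apply/negP => /allP se; have := qP e s y se psy.
      by rewrite leqNgt Esparse.
    move=> /allPn[p ps pe]; exists p; first exact: Xs.
    apply: hP; split=> [|e' [Ee' pe']]; first by split=> //; apply: sd.
    rewrite leqNgt; apply: contraNN pe => lte'y.
    by apply: nodes_subset pe'; apply/kappa_homo/emax.
  (* Here [y] is the first element of [E], and the root is present at every stage. *)
  exists [::] => //; apply: hP; split=> [|e [Ee _]].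
    by split=> //; rewrite mem_nodes.
  rewrite leqNgt; apply/negP => ltey; apply: nE.
  have exE : exists e, `[<E e>] && (e < y).
    by exists e; rewrite ltey andbT; apply/asboolP.
  have Eb e' : `[<E e'>] && (e' < y) -> e' <= y by move=> /andP[_ /ltnW].
  have [e1 /andP[/asboolP Ee1 lte1] e1max] := ex_maxnP exE Eb.
  exists e1; split=> // e' Ee' lte'; apply: e1max; rewrite lte' andbT.
  exact/asboolP.
suff [j hj] : exists j, forall Y, V Y ->
    treelim d W ((fun t => h (take j t)) @^-1` Y).
  by exists (fun t => h (take j t)); apply: ultra_image_RK.
apply: contrapT => nj.
have /choice[Y YP] j : exists Y, V Y /\
    ~ treelim d W ((fun t => h (take j t)) @^-1` Y).
  apply: contrapT => nY; apply: nj; exists j => Y VY.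
  by apply: contrapT => nLY; apply: nY; exists Y.
(* If every level [j] fails at some [Y j], branches can be confined to those with [h (take j t)]
   outside [Y j]. A node [p] hitting a value [y] common to all [Y j] contradicts this at level
   [size p]. *)
pose X := X0 `&` [set t | forall j, j <= d -> (~` Y j) (h (take j t))].
have LX : treelim d W X.
  apply: filterI => //.
  apply: (@filter_forall_leq _ _ d (fun j t => (~` Y j) (h (take j t)))).
  by move=> j _; apply: ultra_setC (YP j).2.
have VY : V [set y | forall j, j <= d -> Y j y].
  by apply: filter_forall_leq => j _; exact: (YP j).1.
have VGX : V (G X) by apply: VG => // t [].
have [y [[Gy Ey] Yy]] := filter_ex (filterI (filterI VGX VE) VY).
have [p Xp hpy] := hit X y LX Gy Ey.
have [t [_ nYt] /prefixP[u tE]] := large_prefix UW Xp.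
have lepd := large_size Xp; have := nYt _ lepd.
by rewrite tE take_size_cat // hpy; apply; apply: Yy.
Qed.

Fixpoint branch_of (n : nat) : iterate_base n -> seq nat :=
  if n is m.+1 return iterate_base n -> seq nat
  then fun x => x.1 :: branch_of x.2 else fun x => [:: x].

Lemma branch_of_inj n : injective (@branch_of n).
Proof.
elim: n => [|n IH] /= => [x y [] //|[x1 x2] [y1 y2] /= [-> /IH ->] //].
Qed.

(** The outer p-point goes to the root and the tree of [V i] below child [i]. The depth is [n.+1]
    because level 0 already has one coordinate. *)
Lemma fubini_iterate_treelim n (U : set_system (iterate_base n)) :
  fubini_iterate n U ->
  exists2 W : seq nat -> set_system nat, (forall p, p_point (W p)) &
    forall A, treelim n.+1 W A <-> U (@branch_of n @^-1` A).
Proof.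
elim: n U => [|n IH] U /=; first by exists (fun=> U).
move=> [W0 [V [pW0 FV ->]]].
have /choice[W WP] i : exists W : seq nat -> set_system nat,
    (forall p, p_point (W p)) /\
    forall A, treelim n.+1 W A <-> V i (@branch_of n @^-1` A).
  by have [W ? ?] := IH _ (FV i); exists W.
exists (fun p => if p is i :: p' then W i p' else W0).
  by case=> [|i p]; [|case: (WP i)].
move=> A; suff -> : [set i | treelim n.+1 (W i) [set t | A (i :: t)]] =
    [set i | V i [set x | A (i :: branch_of x)]] by [].
by rewrite predeqE => i; exact: (WP i).2.
Qed.

(** Take the union of [g X] over the members [X] of [U] inside [A]. If no such union lay inside [B],
    the [X] with [g X] not inside [B] would be cofinal, while none of their images is inside [B]. *)
Lemma tukey_monotone S T (V : set_system S) (U : set_system T) :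
  Filter V -> tukey_le V U ->
  exists f : set T -> set S, [/\ forall A B, A `<=` B -> f A `<=` f B,
    forall A, U A -> V (f A) &
    forall B, V B -> exists2 A, U A & f A `<=` B].
Proof.
move=> FV [g [gV gcof]].
exists (fun A => \bigcup_(X in [set X | U X /\ X `<=` A]) g X); split.
- by move=> A B sAB x [X [UX sXA] gx]; exists X => //; split=> // t /sXA/sAB.
- by move=> A UA; apply: filterS (gV A UA) => x gx; exists A => //; split.
move=> B VB; apply: contrapT => nA.
have [|_ /(_ B VB)[_ [X [_ ngX] <-] //]] :=
  gcof [set X | U X /\ ~ g X `<=` B].
split=> [X []//|A UA]; apply: contrapT => nX; apply: nA; exists A => //.
move=> x [X [UX sXA] gx]; apply: contrapT => nBx; apply: nX.
by exists X => //; split=> // gXB; apply/nBx/gXB.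
Qed.

Theorem theorem5p3 (n : nat) (U : set_system (iterate_base n))
    (V : set_system nat) :
  fubini_iterate n U -> q_point V -> tukey_le V U -> RK_le V U.
Proof.
move=> /fubini_iterate_treelim[W pW UW] qV tVU.
have UE A : U A <-> treelim n.+1 W (@branch_of n @` A).
  rewrite UW; suff -> : @branch_of n @^-1` (@branch_of n @` A) = A by [].
  rewrite eqEsubset; split=> [x [y Ay /branch_of_inj <-] //|].
  exact: preimage_image.
have UV : UltraFilter V by case: qV => -[].
have [f [fmono Vf fcof]] := tukey_monotone _ tVU.
have [|||h ->] :=
  @treelim_RK n.+1 W V (fun A => f (@branch_of n @^-1` A)) pW qV.
- by move=> A B sAB; apply: fmono => x; apply: sAB.
- by move=> A /UW; apply: Vf.
- move=> B /fcof[A UA fA]; exists (@branch_of n @` A); first exact/UE.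
  by apply: subset_trans fA; apply: fmono => x [y Ay /branch_of_inj <-].
exists (h \o @branch_of n); rewrite predeqE => Y /=.
exact: (UW (h @^-1` Y)).
Qed.
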